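(* Let $(G,\sigma)$ be a Hausdorff first-countable $2$-semitopological group. Then the quasitopological group reflexion $G^{qg}=(G,\sigma^{qg})$ of $(G,\sigma)$ is weakly Hausdorff (that is, $(G,\sigma)$ is weakly-$qg$-separated), and there is a topology $\tau$ on $G$ such that $(G,\tau)$ is a semi-metrizable quasitopological group and $\tau$ is coarser than $\sigma^{qg}$ (i.e. $\tau\subset\sigma^{qg}$).
   Context: A semitopological group is a group with a topology making multiplication separately continuous; a quasitopological group is a semitopological group with continuous inversion. A semitopological group $G$ is a $2$-semitopological group if for every $g\in G$ with $e\notin\overline{\{g\}}$ there is a neighborhood $W$ of the neutral element $e$ with $g\notin W^{2}=WW$. For a semitopological group $(G,\sigma)$, the quasitopological group reflexion $G^{qg}=(G,\sigma^{qg})$ is the group $G$ endowed with the strongest topology $\sigma^{qg}\subset\sigma$ that turns $G$ into a quasitopological group. Weak base: let $\mathscr{P}=\bigcup_{x\in X}\mathscr{P}_x$ be a cover of a space $X$ such that for each $x\in X$: (a) if $U,V\in\mathscr{P}_x$ then $W\subset U\cap V$ for some $W\in\mathscr{P}_x$; (b) $x\in\bigcap\mathscr{P}_x$, and whenever $x\in U$ with $U$ open there is $P\in\mathscr{P}_x$ with $P\subset U$. Then $\mathscr{P}$ is a weak base for $X$ if every $A\subset X$ such that for each $x\in A$ there is $P\in\mathscr{P}_x$ with $P\subset A$ is open in $X$. A space $X$ is weakly Hausdorff if there is a weak base $\mathscr{B}$ for $X$ such that for any distinct $x,y\in X$ there are $B_1,B_2\in\mathscr{B}$ with $x\in B_1$,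 $y\in B_2$, $B_1\cap B_2=\emptyset$. A symmetric on a set $X$ is a function $d:X\times X\to[0,+\infty)$ with $d(x,y)=0$ iff $x=y$, and $d(x,y)=d(y,x)$. Put $B(x,\varepsilon)=\{y\in X: d(x,y)<\varepsilon\}$. A space $X$ is semi-metrizable if there is a symmetric $d$ on $X$ such that for each $x\in X$ the family $\{B(x,\varepsilon):\varepsilon>0\}$ is a neighborhood base at $x$. *)

(* Defs.v *)
From HB Require Import structures.
From mathcomp Require Import all_boot all_order all_algebra.
From mathcomp Require Import all_classical all_reals topology.

Set Implicit Arguments.
Unset Strict Implicit.
Unset Printing Implicit Defensive.

Import Order.TTheory GRing.Theory Num.Theory.
Local Open Scope classical_set_scope.
Local Open Scope ring_scope.

Section Spaces.
Variable T : topologicalType.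

(* Members of a neighborhood base are neighborhoods, not necessarily open. *)
Definition nbhs_base (x : T) (B : set_system T) : Prop :=
  B `<=` nbhs x /\ forall A, nbhs x A -> exists2 V, B V & V `<=` A.

Definition first_countable : Prop :=
  forall x : T, exists2 B : set_system T, countable B & nbhs_base x B.

Definition weak_base (B : set_system T) : Prop :=
  exists P : T -> set_system T,
    [/\ B = \bigcup_(x in [set: T]) P x,
        \bigcup_(A in B) A = [set: T],
        forall x U V, P x U -> P x V -> exists2 W, P x W & W `<=` U `&` V,
        forall x, (\bigcap_(A in P x) A) x /\
          forall U, open U -> U x -> exists2 A, P x A & A `<=` U
      & forall A : set T,
          (forall x, A x -> exists2 Q, P x Q & Q `<=` A) -> open A].

Definition weakly_hausdorff : Prop :=
  exists2 B : set_system T, weak_base B &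
    forall x y : T, x <> y ->
      exists B1 B2, [/\ B B1, B B2, B1 x, B2 y & B1 `&` B2 = set0].

End Spaces.

Definition symmetric_on (R : realType) (X : Type) (d : X -> X -> R) : Prop :=
  [/\ forall x y, 0 <= d x y,
      forall x y, d x y = 0 <-> x = y
    & forall x y, d x y = d y x].

Definition symmetric_ball (R : realType) (X : Type) (d : X -> X -> R)
    (x : X) (e : R) : set X :=
  [set y | d x y < e].

Definition semi_metrizable (R : realType) (T : topologicalType) : Prop :=
  exists2 d : T -> T -> R, symmetric_on d &
    forall x : T, nbhs_base x [set symmetric_ball d x e | e in [set e | 0 < e]].

(* Several topologies on one carrier are compared: a topology on [T] is an
   element [t] of the class [Topological T], and [Topological.Pack t] is the
   corresponding space. *)
Definition coarser (T : Type) (s t : Topological T) : Prop :=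
  @open (Topological.Pack s) `<=` @open (Topological.Pack t).

Section Groups.
Variable G : groupType.
Implicit Types s t : Topological G.

Definition continuous_for t (f : G -> G) : Prop :=
  continuous (f : Topological.Pack t -> Topological.Pack t).

Definition semitopological t : Prop :=
  forall g : G, continuous_for t (fun x => (g * x)%g) /\
                continuous_for t (fun x => (x * g)%g).

Definition quasitopological t : Prop :=
  semitopological t /\ continuous_for t (fun x => (x^-1)%g).

Definition set_mulg (A B : set G) : set G :=
  [set z | exists x y, [/\ A x, B y & z = (x * y)%g]].

Definition two_semitopological t : Prop :=
  semitopological t /\
  forall g : G, ~ @closure (Topological.Pack t) [set g] 1%g ->
    exists2 W : set G,
      @nbhs _ (Topological.Pack t) (1%g : Topological.Pack t) W
      & ~ set_mulg W W g.

Definition is_qg_reflexion s t : Prop :=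
  [/\ coarser t s, quasitopological t
    & forall t', coarser t' s -> quasitopological t' -> coarser t' t].

Lemma continuous_forP t f :
  continuous_for t f <->
  forall A : set G, @open (Topological.Pack t) A ->
    @open (Topological.Pack t) (f @^-1` A).
Proof. exact: (@continuousP (Topological.Pack t) (Topological.Pack t)). Qed.

Lemma coarser_anti s t : coarser s t -> coarser t s ->
  @open (Topological.Pack s) = @open (Topological.Pack t) :> set (set G).
Proof. by move=> st ts; apply/seteqP. Qed.

End Groups.

(* [s] is a phantom argument: the topology put on [inv_space s] depends on it. *)
Definition inv_space (G : groupType) (s : Topological G) : Type := G.

(* The reflexion of a semitopological group always exists: it consists of the
   sets [A] such that [A] and [A^-1] are both open in [s]. *)
Section Existence.
Variables (G : groupType) (s : Topological G).
Let S := Topological.Pack s.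

Definition inv_open : set_system G :=
  [set A : set G | @open S A /\ @open S [set x | A (x^-1)%g]].

Let opT : inv_open setT.
Proof. by split; exact: (@openT S). Qed.

Let opI : setI_closed inv_open.
Proof. by move=> A B [Ao Ai] [Bo Bi]; split; exact: (@openI S). Qed.

Let opU (I : Type) (f : I -> set G) :
  (forall i, inv_open (f i)) -> inv_open (\bigcup_i f i).
Proof.
move=> fo; split; first by apply: (@bigcup_open S) => i _; case: (fo i).
rewrite (_ : [set x | _] = \bigcup_i [set x | f i (x^-1)%g]); last first.
  by apply/seteqP; split.
by apply: (@bigcup_open S) => i _; case: (fo i).
Qed.

HB.instance Definition _ := Choice.on (inv_space s).
HB.instance Definition _ := isOpenTopological.Build (inv_space s) opT opI opU.

Definition inv_topology : Topological G :=
  Topological.class (inv_space s).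

Lemma qg_reflexion_exists :
  semitopological s -> is_qg_reflexion s inv_topology.
Proof.
move=> hs.
have opE (A : set G) :
  @open (Topological.Pack inv_topology) A = inv_open A by [].
have hl g A : @open S A -> @open S [set x | A (g * x)%g].
  by have [/continuous_forP h _] := hs g; exact: h.
have hr g A : @open S A -> @open S [set x | A (x * g)%g].
  by have [_ /continuous_forP h] := hs g; exact: h.
split.
- by move=> A [].
- split=> [g|].
    split; apply/continuous_forP => A [Ao Ai]; rewrite opE; split.
    + exact: hl.
    + rewrite (_ : [set x | A (g * x^-1)%g] = [set x | A ((x * g^-1)^-1)%g]);
        first exact: (hr _ [set x | A (x^-1)%g]).
      by apply/seteqP; split=> x; rewrite /= invgM invgK.
    + exact: hr.
    + rewrite (_ : [set x | A (x^-1 * g)%g] = [set x | A ((g^-1 * x)^-1)%g]);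
        first exact: (hl _ [set x | A (x^-1)%g]).
      by apply/seteqP; split=> x; rewrite /= invgM invgK.
  apply/continuous_forP => A [Ao Ai]; rewrite opE; split=> //.
  rewrite (_ : [set x | _] = A) //.
  by apply/seteqP; split=> x; rewrite /= invgK.
- move=> t' ts [_ /continuous_forP ti] A Ao; rewrite opE; split; first exact: ts.
  by apply: ts; exact: ti.
Qed.

End Existence.

(* Main.v *)
(** A set is open in the reflexion exactly when it and its inverse are
    [sigma]-open, so the sets [x (U `|` U^-1)], with [U] a neighborhood of [1],
    form a weak base.  Two of them, around [x] and [y], are disjoint as soon as
    [x^-1 y] avoids [U U], [U^-1 U^-1], [U U^-1] and [U^-1 U]: the first two are
    the 2-semitopological condition, the last two the Hausdorff property.

    The sets [U U^-1] with [U] open are symmetric, and they form a neighborhood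
    base at [1] of a quasitopological group topology [tau]: if
    [u U_1 `<=` U], [U_2 v `<=` U] and [v^-1 U_2 v `<=` U_1], then
    [u v^-1 (U_2 U_2^-1) `<=` U U^-1].  Since [sigma] is Hausdorff they meet in
    [1] only, so a countable base of [sigma] at [1] provides a semi-metric. *)
Require Import Defs.
From HB Require Import structures.
From mathcomp Require Import all_boot all_order all_algebra.
From mathcomp Require Import all_classical all_reals topology.

Set Implicit Arguments.
Unset Strict Implicit.
Unset Printing Implicit Defensive.

Import Order.TTheory GRing.Theory Num.Theory.
Local Open Scope classical_set_scope.
Local Open Scope group_scope.

Lemma hausdorff_separated (T : topologicalType) (x y : T) :
  hausdorff_space T -> x <> y ->
  exists A B, [/\ nbhs x A, nbhs y B & forall z, A z -> B z -> False].
Proof.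
move=> hT xy; apply: contrapT => nsep; apply/xy/hT => A B xA yB.
apply: contrapT => AB0; apply: nsep; exists A, B; split=> // z Az Bz.
by apply: AB0; exists z.
Qed.

(** * Translations, and products of neighborhoods of [1] that avoid a point *)

Section Semitopological.
Variables (G : groupType) (s : Topological G).
Hypothesis semitop_s : semitopological s.
Local Notation S := (Topological.Pack s).
Local Notation nbhs1 := (@nbhs S S (1%g : G)).

Lemma nbhs_mull (g x : G) (A : set G) :
  @nbhs S S (g * x) A -> @nbhs S S x [set y | A (g * y)].
Proof. by have [h _] := semitop_s g; exact: h. Qed.

Lemma nbhs_mulr (g x : G) (A : set G) :
  @nbhs S S (x * g) A -> @nbhs S S x [set y | A (y * g)].
Proof. by have [_ h] := semitop_s g; exact: h. Qed.

Lemma nbhs1_conj (g : G) (A : set G) :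
  nbhs1 A -> nbhs1 [set y | A (g^-1 * y * g)].
Proof.
move=> A1; apply: (@nbhs_mull g^-1 1 [set y | A (y * g)]).
by apply: nbhs_mulr; rewrite mulg1 mulVg.
Qed.

Section Separation.
Hypothesis hausdorff_s : hausdorff_space S.

(** With [A] around [g] and [B] around [1] disjoint, [g = u * v^-1] would put [u = g * v] in
    both. *)
Lemma notin_mulV (g : G) : g <> 1 ->
  exists2 U, nbhs1 U & forall u v, U u -> U v -> g <> u * v^-1.
Proof.
move=> g1; have [A [B [gA B1 AB]]] := hausdorff_separated hausdorff_s g1.
exists (B `&` [set u | A (g * u)]).
  by apply: filterI => //; apply: nbhs_mull; rewrite mulg1.
move=> u v [Bu _] [_ /= Av] guv; apply: (AB u) => //.
by rewrite guv mulgVK in Av.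
Qed.

Lemma notin_Vmul (g : G) : g <> 1 ->
  exists2 U, nbhs1 U & forall u v, U u -> U v -> g <> u^-1 * v.
Proof.
move=> g1; have [A [B [gA B1 AB]]] := hausdorff_separated hausdorff_s g1.
exists (B `&` [set u | A (u * g)]).
  by apply: filterI => //; apply: nbhs_mulr; rewrite mul1g.
move=> u v [_ /= Au] [Bv _] guv; apply: (AB v) => //.
by rewrite guv mulVKg in Au.
Qed.

Lemma notin_mul (g : G) : two_semitopological s -> g <> 1 ->
  exists2 U, nbhs1 U & forall u v, U u -> U v -> g <> u * v.
Proof.
(* In a Hausdorff space [g <> 1] keeps [1] out of the closure of [[set g]], which is the premise of
   the 2-semitopological condition. *)
move=> [_ s2] g1; have /s2[W W1 Wg] : ~ @closure S [set g] 1.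
  move=> clg; apply: g1; apply: hausdorff_s => A B gA B1.
  have [_ [-> Bg]] := clg _ B1; exists g; split=> //.
  exact: (@nbhs_singleton S).
by exists W => // u v Wu Wv guv; apply: Wg; exists u, v.
Qed.

End Separation.

(** * A weak base of the reflexion *)

Definition sym_translate (x : G) (U : set G) : set G :=
  [set y | U (x^-1 * y) \/ U (y^-1 * x)].

(** The first disjunct of [sym_translate] governs openness of [A], the second openness of the
    inverse of [A]. *)
Lemma inv_openP (A : set G) :
  (forall x, A x -> exists2 U, nbhs1 U & sym_translate x U `<=` A) <->
  inv_open s A.
Proof.
split=> [hA|[Ao Ai] x Ax].
  split; rewrite openE => x /= Ax.
    have [U U1 UA] := hA _ Ax.
    have : @nbhs S S x [set y | U (x^-1 * y)] by apply: nbhs_mull; rewrite mulVg.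
    by apply: filterS => y Uy; apply: UA; left.
  have [U U1 UA] := hA _ Ax.
  have : @nbhs S S x [set y | U (y * x^-1)] by apply: nbhs_mulr; rewrite mulgV.
  by apply: filterS => y Uy; apply: UA; right; rewrite invgK.
(* [(u * x^-1)^-1] is [x * u^-1], written so that a right translation leads into the open inverse of
   [A]. *)
exists ([set u | A (x * u)] `&` [set u | A ((u * x^-1)^-1)]).
  apply: filterI; first by apply: nbhs_mull; rewrite mulg1; exact: open_nbhs_nbhs.
  apply: (@nbhs_mulr x^-1 1 [set z | A z^-1]); rewrite mul1g.
  by apply: open_nbhs_nbhs; split=> //=; rewrite invgK.
move=> y [[/= + _]|[_ /=]]; first by rewrite mulVKg.
by rewrite mulgK invgK.
Qed.

Definition sym_translates (x : G) : set_system G :=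
  [set sym_translate x U | U in nbhs1].

Lemma weak_base_sym_translates (t : Topological G) :
  @open (Topological.Pack t) = inv_open s ->
  @weak_base (Topological.Pack t) (\bigcup_x sym_translates x).
Proof.
move=> topen; exists sym_translates; split=> //.
- apply/seteqP; split=> // x _; exists (sym_translate x setT); last by left.
  by exists x => //; exists setT => //; exact: filterT.
- move=> x _ _ [U U1 <-] [V V1 <-]; exists (sym_translate x (U `&` V)).
    by exists (U `&` V) => //; exact: filterI.
  by move=> y [[? ?]|[? ?]]; split; [left|left|right|right].
- move=> x; split=> [_ [U U1 <-]|A].
    by left; rewrite mulVg; exact: (@nbhs_singleton S).
  rewrite topen => /inv_openP Ao /Ao[U U1 UA].
  by exists (sym_translate x U) => //; exists U.
- move=> A hA; rewrite topen; apply/inv_openP => x /hA[_ [U U1 <-] UA].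
  by exists U.
Qed.

Lemma weakly_hausdorff_inv_open (t : Topological G) :
  hausdorff_space S -> two_semitopological s ->
  @open (Topological.Pack t) = inv_open s ->
  weakly_hausdorff (Topological.Pack t).
Proof.
move=> hS s2 topen; exists (\bigcup_x sym_translates x).
  exact: weak_base_sym_translates.
move=> x y xy.
have g1 : x^-1 * y <> 1.
  by move=> /mulg1_eq; rewrite invgK.
(* Keeping [x^-1 * y] out of [U^-1 U^-1] means keeping its inverse [y^-1 * x] out of [U U]. *)
have h1 : y^-1 * x <> 1.
  by move=> /mulg1_eq; rewrite invgK => /esym.
have [U1 ? sep1] := notin_mul hS s2 g1.
have [U2 ? sep2] := notin_mul hS s2 h1.
have [U3 ? sep3] := notin_mulV hS g1.
have [U4 ? sep4] := notin_Vmul hS g1.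
pose U := (U1 `&` U2) `&` (U3 `&` U4).
have nU : nbhs1 U by apply: filterI; apply: filterI.
exists (sym_translate x U), (sym_translate y U); split.
- by exists x => //; exists U.
- by exists y => //; exists U.
- by left; rewrite mulVg; exact: (@nbhs_singleton S).
- by left; rewrite mulVg; exact: (@nbhs_singleton S).
(* A common point [z] puts [x^-1 * y] in [U U^-1], [U U], [U^-1 U^-1] or [U^-1 U], in this order. *)
apply/seteqP; split=> // z [[] [[? ?] [? ?]] [] [[? ?] [? ?]]].
- by apply: (sep3 (x^-1 * z) (y^-1 * z)); rewrite // invgM invgK mulgA mulgK.
- by apply: (sep1 (x^-1 * z) (z^-1 * y)); rewrite // mulgA mulgK.
- by apply: (sep2 (y^-1 * z) (z^-1 * x)); rewrite // mulgA mulgK.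
- by apply: (sep4 (z^-1 * x) (z^-1 * y)); rewrite // invgM invgK mulgA mulgK.
Qed.

End Semitopological.

(* [s] is a phantom argument: the topology put on [mulV_space s] depends on it. *)
Definition mulV_space (G : groupType) (s : Topological G) : Type := G.

(** * The topology [tau] with basic neighborhoods [x U U^-1] *)

Section MulVTopology.
Variables (G : groupType) (s : Topological G).
Local Notation S := (Topological.Pack s).
Local Notation nbhs1 := (@nbhs S S (1%g : G)).

Definition mulV_near (x : G) (A : set G) : Prop :=
  exists2 U, nbhs1 U & forall u v, U u -> U v -> A (x * (u * v^-1)).

(** Openness is imposed pointwise, so a [mulV_near] set is not yet known to be a neighborhood;
    [mulV_nbhsP] settles this. *)
Definition mulV_open : set_system G :=
  [set A | forall x, A x -> mulV_near x A].

Let opT : mulV_open setT.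
Proof. by move=> x _; exists setT => //; exact: filterT. Qed.

Let opI : setI_closed mulV_open.
Proof.
move=> A B Ao Bo x [/Ao[U U1 UA] /Bo[V V1 VB]].
exists (U `&` V); first exact: filterI.
by move=> u v [? ?] [? ?]; split; [exact: UA|exact: VB].
Qed.

Let opU (I : Type) (f : I -> set G) :
  (forall i, mulV_open (f i)) -> mulV_open (\bigcup_i f i).
Proof.
move=> fo x [i _ /fo[U U1 Uf]]; exists U => // u v Uu Uv.
by exists i => //; exact: Uf.
Qed.

HB.instance Definition _ := Choice.on (mulV_space s).
HB.instance Definition _ := isOpenTopological.Build (mulV_space s) opT opI opU.

Definition mulV_topology : Topological G := Topological.class (mulV_space s).
Local Notation T := (Topological.Pack mulV_topology).

Lemma mulV_openE : @open T = mulV_open. Proof. by []. Qed.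

Hypothesis semitop_s : semitopological s.

Lemma mulV_topology_coarser : coarser mulV_topology s.
Proof.
move=> A; rewrite mulV_openE => Ao; rewrite openE => x /= /Ao[U U1 UA].
have : @nbhs S S x [set y | U (x^-1 * y)].
  by apply: nbhs_mull; rewrite ?mulVg.
(* The choice [v = 1] shows that [x U] lies in [x U U^-1]. *)
apply: filterS => y Uy; have := UA _ _ Uy (@nbhs_singleton S _ _ U1).
by rewrite invg1 mulg1 mulVKg.
Qed.

(** Left translations keep [U]; the other maps conjugate it: [u v^-1 g = g (g^-1 u g) (g^-1 v g)^-1]
    and [(x u v^-1)^-1 = x^-1 (x v x^-1) (x u x^-1)^-1]. *)
Lemma mulV_topology_quasitopological : quasitopological mulV_topology.
Proof.
split=> [g|].
  split; apply/continuous_forP => A; rewrite mulV_openE => Ao x /= /Ao[U U1 UA].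
    by exists U => // u v Uu Uv /=; rewrite mulgA; exact: UA.
  exists [set u | U (g^-1 * u * g)]; first exact: nbhs1_conj.
  move=> u v /= Uu Uv; have := UA _ _ Uu Uv.
  by rewrite !invgM invgK !mulgA mulgK mulgK.
apply/continuous_forP => A; rewrite mulV_openE => Ao x /= /Ao[U U1 UA].
exists [set u | U (x^-1^-1 * u * x^-1)]; first exact: nbhs1_conj.
move=> u v /= Uu Uv; have := UA _ _ Uv Uu.
by rewrite !invgM !invgK !mulgA mulVg mul1g mulgVK.
Qed.

Lemma mulV_open_mulV (x : G) (U : set G) : @open S U ->
  mulV_open [set y | exists u v, [/\ U u, U v & y = x * (u * v^-1)]].
Proof.
move=> Uo _ [u [v [Uu Uv ->]]].
have nU w : U w -> @nbhs S S w U by move=> Uw; exact: open_nbhs_nbhs.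
have U1 : nbhs1 [set w | U (u * w)].
  by apply: (nbhs_mull semitop_s); rewrite mulg1; exact: nU.
have U2 : nbhs1 [set w | U (w * v)].
  by apply: (nbhs_mulr semitop_s); rewrite mul1g; exact: nU.
exists ([set w | U (w * v)] `&` [set w | U (u * (v^-1 * w * v))]).
  by apply: filterI => //; exact: (nbhs1_conj semitop_s v U1).
(* The witnesses come from [u v^-1 a b^-1 = (u v^-1 a v) (b v)^-1]. *)
move=> a b [_ /= Ua] [/= Ub _]; exists (u * (v^-1 * a * v)), (b * v).
by split=> //; rewrite invgM !mulgA mulgK.
Qed.

(** Every neighborhood of [1] contains an open [V] around [1], and then [x V V^-1] is open in
    [tau]. *)
Lemma mulV_nbhsP (x : G) (A : set G) : @nbhs T T x A <-> mulV_near x A.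
Proof.
split=> [|[U U1 UA]].
  rewrite nbhsE => -[B [+ Bx] BA]; rewrite mulV_openE => /(_ _ Bx)[U U1 UB].
  by exists U => // u v Uu Uv; apply: BA; exact: UB.
move: U1; rewrite nbhsE => -[V [Vo V1] VU]; rewrite nbhsE.
exists [set y | exists u v, [/\ V u, V v & y = x * (u * v^-1)]]; last first.
  by move=> _ [u [v [Vu Vv ->]]]; apply: UA; exact: VU.
split; first exact: mulV_open_mulV.
by exists 1, 1; split=> //; rewrite invg1 !mulg1.
Qed.

End MulVTopology.

(* Take [0] if [A] is full and [1 / n.+1] for the least [n] outside [A]
   otherwise. *)
Lemma initial_segment_size (R : realType) :
  exists f : set nat -> R, forall A, [/\ (0 <= f A)%R,
    f A = 0%R <-> A = setT &
    forall n, (f A < n.+1%:R^-1)%R <-> forall i, (i <= n)%N -> A i].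
Proof.
suff [f fP] : {f : set nat -> R & forall A, [/\ (0 <= f A)%R,
    f A = 0%R <-> A = setT &
    forall n, (f A < n.+1%:R^-1)%R <-> forall i, (i <= n)%N -> A i]}.
  by exists f.
apply: (@choice _ _ (fun A r => [/\ (0 <= r)%R, r = 0%R <-> A = setT &
    forall n, (r < n.+1%:R^-1)%R <-> forall i, (i <= n)%N -> A i])) => A.
have [->|AT] := pselect (A = setT).
  by exists 0%R; split=> // n; split=> // _; rewrite invr_gt0 ltr0n.
have exN : exists n, ~~ `[< A n >].
  apply: contrapT => nA; apply: AT; apply/seteqP; split=> // n _.
  by apply: contrapT => An; apply: nA; exists n; apply/asboolP.
case: (ex_minnP exN) => N /asboolP NA minN.
exists (N.+1%:R^-1)%R; split=> [|//|n].
- by rewrite invr_ge0 ler0n.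
- by split=> // /eqP; rewrite invr_eq0 pnatr_eq0.
- rewrite ltf_pV2 ?posrE ?ltr0n// ltr_nat ltnS; split=> [nN i le_in|An].
    apply: contrapT => Ai; have : (N <= i)%N by apply: minN; apply/asboolP.
    by rewrite leqNgt (leq_ltn_trans le_in nN).
  by rewrite ltnNge; apply/negP => /An.
Qed.

(** * First countability and the semi-metric *)

Lemma countable_nbhs_base_seq (T : topologicalType) (x : T) :
  (exists2 B : set_system T, countable B & nbhs_base x B) ->
  exists2 b : nat -> set T, (forall n, nbhs x (b n)) &
    forall A, nbhs x A -> exists n, b n `<=` A.
Proof.
move=> [B cB [Bx Bbase]].
(* A countable [B] is empty or the image of a sequence; a base is not empty, as some member lies in
   [setT]. *)
have /pfcard_geP[B0|[f]] : (B #<= [set: nat])%card by [].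
  by have [V] := Bbase _ (@filterT _ (nbhs x) _); rewrite B0.
exists f => [n|A /Bbase[V BV VA]]; first by apply: Bx; exact: funS.
by have [n _ fn] := (@surj _ _ _ _ f) _ BV; exists n; rewrite fn.
Qed.

(** The distance records the first [n] with [x^-1 * y] outside [W n], so the ball of radius
    [1 / n.+1] at [x] is the intersection of the [x W i] for [i <= n]. Initial segments make this
    work without a decreasing base. *)
Lemma mulV_topology_semi_metrizable (R : realType) (G : groupType)
    (s : Topological G) :
  hausdorff_space (Topological.Pack s) -> first_countable (Topological.Pack s) ->
  semitopological s ->
  semi_metrizable R (Topological.Pack (mulV_topology s)).
Proof.
move=> hS cS sS.
have [b b1 bbase] := countable_nbhs_base_seq (cS 1).
pose W n (g : G) := exists u v, [/\ b n u, b n v & g = u * v^-1].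
have WV n (g : G) : W n g -> W n g^-1.
  by move=> [u [v [bu bv ->]]]; exists v, u; rewrite invgM invgK.
have W1 n : W n 1.
  have bn1 := @nbhs_singleton (Topological.Pack s) _ _ (b1 n).
  by exists 1, 1; rewrite mulgV.
have WT (g : G) : [set n | W n g] = setT <-> g = 1.
  split=> [Wg|->]; last by apply/seteqP; split=> // n _; exact: W1.
  apply: contrapT => g1; have [U /bbase[n bU] Ug] := notin_mulV sS hS g1.
  have : [set n | W n g] n by rewrite Wg.
  by move=> [u [v [/bU Uu /bU Uv]]]; exact: Ug.
have [f fP] := initial_segment_size R.
pose d (x y : G) : R := f [set n | W n (x^-1 * y)].
have fball n x y : (d x y < n.+1%:R^-1)%R <->
    forall i, (i <= n)%N -> W i (x^-1 * y).
  by have [_ _] := fP [set n | W n (x^-1 * y)]; exact.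
exists d; first split=> [x y|x y|x y].
- by have [] := fP [set n | W n (x^-1 * y)].
- have [_ -> _] := fP [set n | W n (x^-1 * y)].
  split=> [/WT xy|->]; last by apply/WT; rewrite mulVg.
  by rewrite -[y](mulVKg x) xy mulg1.
- congr f; apply/seteqP; split=> n /= /WV; by rewrite invgM invgK.
move=> x; split=> [_ [e e0 <-]|A].
  apply/(mulV_nbhsP sS).
  have [n ne] : exists n, (n.+1%:R^-1 < e)%R.
    exists (Num.truncn (e^-1)%R).
    by rewrite invf_plt ?posrE ?ltr0n//; exact: truncnS_gt.
  (* For this intersection [U], the set [U U^-1] lies in every [W i] with [i <= n]. *)
  exists (\bigcap_(i in [set i | (i <= n)%N]) b i).
    elim: n {ne} => [|m IHm].
      by apply: filterS (b1 0) => y by0 i /=; rewrite leqn0 => /eqP->.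
    apply: filterS (filterI IHm (b1 m.+1)) => y [ym yS] i /=.
    by rewrite leq_eqVlt => /predU1P[->//|]; rewrite ltnS; exact: ym.
  move=> u v bu bv; apply: lt_trans ne; apply/fball => i le_in.
  by exists u, v; rewrite mulKg; split=> //; [exact: bu|exact: bv].
move=> /(mulV_nbhsP sS)[U /bbase[n bU] UA].
exists (symmetric_ball d x (n.+1%:R^-1)%R).
  by exists (n.+1%:R^-1)%R => //=; rewrite invr_gt0 ltr0n.
move=> y /fball/(_ n (leqnn n))[u [v [/bU Uu /bU Uv xy]]].
by rewrite -[y](mulVKg x) xy; exact: UA.
Qed.

Theorem theorem3p5 (R : realType) (G : groupType)
    (sigma sigma_qg : Topological G)
    (Hhausdorff : hausdorff_space (Topological.Pack sigma))
    (Hcountable : first_countable (Topological.Pack sigma))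
    (H2semi : two_semitopological sigma)
    (Hreflexion : is_qg_reflexion sigma sigma_qg) :
  weakly_hausdorff (Topological.Pack sigma_qg) /\
  exists tau : Topological G,
    [/\ semi_metrizable R (Topological.Pack tau),
        quasitopological tau
      & coarser tau sigma_qg].
Proof.
have [semi_sigma _] := H2semi.
have [qg_le qg_quasi qg_max] := Hreflexion; split.
  have [inv_le inv_quasi inv_max] := qg_reflexion_exists semi_sigma.
  apply: (weakly_hausdorff_inv_open semi_sigma) => //.
  (* Both topologies are reflexions, so by maximality each is coarser than the other and they have
     the same open sets. *)
  apply: (@coarser_anti _ sigma_qg (inv_topology sigma)); first exact: inv_max.
  exact: qg_max.
exists (mulV_topology sigma).
have tau_quasi := mulV_topology_quasitopological semi_sigma.
split=> //; first exact: mulV_topology_semi_metrizable.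
by apply: qg_max => //; exact: mulV_topology_coarser.
Qed.
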